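(* There is a $2$-DFAO with $49$ states that, for every $n \geq 1$, on input $n$ written in base $2$, outputs the set $$\mathrm{ace}(n) = \{ \mathrm{cce}(x) : x \text{ is a factor of } \mathbf{t},\ |x| = n \}$$ of all circular critical exponents of length-$n$ factors of the Thue-Morse word $\mathbf{t}$.
   Context: The Thue-Morse word $\mathbf{t} = t_0 t_1 t_2 \cdots = 01101001\cdots$ is the infinite fixed point, starting with $0$, of the morphism $\mu$ with $\mu(0)=01$, $\mu(1)=10$. A nonempty finite word $w$ (indexed from $0$) has period $p$, where $1 \le p \le |w|$, if $w[i]=w[i+p]$ for all $i$ with $0 \le i < |w|-p$. The smallest period of $w$ is denoted $p(w)$, and the exponent of $w$ is $\exp(w) = |w|/p(w)$. A factor of a word is a contiguous block inside it. The conjugates of a finite word $w$ are its cyclic shifts, i.e. the words $yx$ with $w = xy$ ($x,y$ possibly empty). The circular critical exponent $\mathrm{cce}(w)$ of a nonempty finite word $w$ is the supremum (maximum) of $\exp(x)$ over all nonempty factors $x$ of all conjugates of $w$. A $k$-DFAO (deterministic finite automaton with output) is $M=(Q,\Sigma_k,\delta,q_0,\Delta,\tau)$, where $Q$ is a finite nonempty set of states, $\Sigma_k=\{0,1,\ldots,k-1\}$ is the input alphabet, $\delta:Q\times\Sigma_k\to Q$ is the transition function (extended to $Q\times\Sigma_k^*$ in the usual way), $q_0\in Q$ is the initial state, $\Delta$ is the (finite) output alphabet (here a finite collection of finite sets of rational numbers), and $\tau:Q\to\Delta$ is the output map. On input $x \in \Sigma_k^*$ it outputs $\tau(\delta(q_0,x))$.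 The base-$2$ representation of $n$ is read starting with the most significant digit. *)

(* Defs.v *)
From HB Require Import structures.
From mathcomp Require Import all_boot all_order all_algebra.
From mathcomp Require Import finmap classical_sets.

Set Implicit Arguments.
Unset Strict Implicit.
Unset Printing Implicit Defensive.

Import Order.TTheory GRing.Theory Num.Theory.

(* Binary words are of type seq bool: the letters 0 and 1 are false and true. *)

Definition mu (w : seq bool) : seq bool := flatten [seq [:: b; ~~ b] | b <- w].

(* mu^n(0) has length 2 ^ n > n and is a prefix of mu^(n+1)(0). *)
Definition thue_morse (n : nat) : bool := nth false (iter n mu [:: false]) n.

Definition infinite_factor (x : seq bool) (t : nat -> bool) : Prop :=
  exists i, x = mkseq (fun j => t (i + j)) (size x).

Definition is_period (w : seq bool) (p : nat) : bool :=
  (1 <= p <= size w) &&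
  all (fun i => nth false w i == nth false w (i + p)) (iota 0 (size w - p)).

(* The p-th item of iota 0 _ is p, so that find returns the least period. *)
Definition period (w : seq bool) : nat :=
  find (is_period w) (iota 0 (size w).+1).

Definition exponent (w : seq bool) : rat :=
  ((size w)%:R / (period w)%:R)%R.

Definition conjugates (w : seq bool) : seq (seq bool) :=
  [seq rot i w | i <- iota 0 (size w).+1].

Definition factors (w : seq bool) : seq (seq bool) :=
  [seq take j (drop i w) | i <- iota 0 (size w).+1, j <- iota 0 (size w).+1].

(* Exponents of nonempty words are at least 1, so the default 0 is never the
   maximum when w is nonempty. *)
Definition cce (w : seq bool) : rat :=
  \big[Num.max/0%R]_(u <- conjugates w)
    \big[Num.max/0%R]_(x <- factors u | x != [::]) exponent x.

Definition ace (n : nat) : set rat :=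
  [set r | exists x : seq bool,
     [/\ infinite_factor x thue_morse, size x = n & cce x = r]]%classic.

Record dfao (k : nat) (D : choiceType) := Dfao {
  dfao_state : finType;
  dfao_init : dfao_state;
  dfao_trans : dfao_state -> 'I_k -> dfao_state;
  dfao_alphabet : {fset D};
  dfao_tau : dfao_state -> dfao_alphabet
}.

Definition dfao_output (k : nat) (D : choiceType) (M : dfao k D)
    (x : seq 'I_k) : D :=
  val (dfao_tau (foldl (@dfao_trans k D M) (dfao_init M) x)).

Fixpoint base2_rec (fuel n : nat) : seq 'I_2 :=
  if fuel is fuel'.+1 then
    if n == 0 then [::] else rcons (base2_rec fuel' n./2) (inZp n)
  else [::].

(* Most significant digit first, without leading zeros. *)
Definition base2 (n : nat) : seq 'I_2 := base2_rec n n.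

Lemma size_mu w : size (mu w) = (size w).*2.
Proof. by elim: w => //= b w IH; rewrite /mu /= in IH *; rewrite IH. Qed.

Lemma mu_cat u v : mu (u ++ v) = mu u ++ mu v.
Proof. by rewrite /mu map_cat flatten_cat. Qed.

Lemma nth_mu w i : i < (size w).*2 ->
  nth false (mu w) i = odd i (+) nth false w i./2.
Proof.
elim: w i => [|b w IH] [|[|i]] //=; rewrite ?doubleS ?ltnS => Hi.
by rewrite negbK; exact: IH.
Qed.

Lemma size_iter_mu n : size (iter n mu [:: false]) = 2 ^ n.
Proof. by elim: n => //= n IH; rewrite size_mu IH expnS mul2n. Qed.

Lemma nth_iter_mu m n i : m <= n -> i < 2 ^ m ->
  nth false (iter n mu [:: false]) i = nth false (iter m mu [:: false]) i.
Proof.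
move=> le_mn lt_im; rewrite -(subnKC le_mn); elim: (n - m) => [|d IH].
  by rewrite addn0.
rewrite addnS -IH; have [s ->]: exists s,
    iter (m + d).+1 mu [:: false] = iter (m + d) mu [:: false] ++ s.
  elim: (m + d) => [|e [s Es]]; first by exists [:: true].

  by exists (mu s); rewrite [LHS]iterS [in LHS]Es mu_cat.
by rewrite nth_cat size_iter_mu (leq_trans lt_im) // leq_exp2l // leq_addr.
Qed.

Lemma thue_morse0 : thue_morse 0 = false.
Proof. by []. Qed.

Lemma thue_morse_fixed n :
  mu (mkseq thue_morse n) = mkseq thue_morse n.*2.
Proof.
apply: (@eq_from_nth _ false) => [|i]; rewrite size_mu !size_mkseq // => Hi.
have lt2 k : k < 2 ^ k by exact: ltn_expl.
have le_half : i./2 <= i by rewrite leq_half_double -addnn -addnS leq_addr.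
rewrite nth_mu ?size_mkseq // !nth_mkseq // ?ltn_half_double // /thue_morse.
rewrite -(@nth_iter_mu i i.+1 i) // iterS nth_mu; last first.
  by rewrite size_iter_mu -mul2n -expnS (leq_trans (lt2 i)) // leq_exp2l.
by rewrite (@nth_iter_mu i./2 i i./2).
Qed.

Lemma periodP w : w != [::] ->
  is_period w (period w) /\ (forall p, is_period w p -> period w <= p).
Proof.
move=> w0; have szw : is_period w (size w).
  by rewrite /is_period subnn /= leqnn andbT lt0n size_eq0 w0.
have hasw : has (is_period w) (iota 0 (size w).+1).
  by apply/hasP; exists (size w) => //; rewrite mem_iota ltnS leqnn.
split; first by have := nth_find 0 hasw; rewrite nth_iota // -[X in _ < X](size_iota 0) -has_find.
move=> p wp; rewrite leqNgt; apply/negP => lt_p.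
have := before_find 0 lt_p; rewrite nth_iota ?add0n ?wp //.
by case/andP: wp => /andP[_]; rewrite ltnS.
Qed.

Lemma mem_conjugates u w :
  reflect (exists x y, w = x ++ y /\ u = y ++ x) (u \in conjugates w).
Proof.
apply: (iffP mapP) => [[i _ ->]|[x [y [-> ->]]]].
  by exists (take i w), (drop i w); rewrite cat_take_drop.
exists (size x); last by rewrite rot_size_cat.
by rewrite mem_iota size_cat ltnS leq_addr.
Qed.

Lemma mem_factors x w : (x \in factors w) = infix x w.
Proof.
apply/allpairsP/infixP => [[[i j] /= [_ _ ->]]|[u [v ->]]].
  by exists (take i w), (drop j (drop i w)); rewrite !cat_take_drop.
exists (size u, size x); split.
- by rewrite mem_iota /= add0n size_cat ltnS leq_addr.
- by rewrite mem_iota /= add0n !size_cat ltnS addnCA leq_addr.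
- by rewrite /= drop_size_cat // take_size_cat.
Qed.

Lemma cce_ge w u x : u \in conjugates w -> infix x u -> x != [::] ->
  (exponent x <= cce w)%R.
Proof.
move=> uw xu x0; rewrite -mem_factors in xu.
apply: (@bigmax_sup_seq _ _ _ _ _ u) => //.
exact: (le_bigmax_seq _ _ _ _ xu x0).
Qed.

Lemma bigmax_attained (T : eqType) (s : seq T) (P : pred T) (F : T -> rat) :
  let m := \big[Num.max/0%R]_(x <- s | P x) F x in
  m = 0%R \/ exists x, [/\ x \in s, P x & m = F x].
Proof.
move=> m; rewrite /m; elim: s {m} => [|y s IH]; first by left; rewrite big_nil.
rewrite big_cons; case: ifP => Py; last first.
  by case: IH => [|[x [xs Px Ex]]]; [left | right; exists x; rewrite inE xs orbT].
case: leP => _; last by right; exists y; rewrite inE eqxx.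
by case: IH => [|[x [xs Px Ex]]]; [left | right; exists x; rewrite inE xs orbT].
Qed.

Lemma exponent_gt0 w : w != [::] -> (0 < exponent w)%R.
Proof.
move=> w0; have [/andP[/andP[p0 _] _] _] := periodP w0.
by rewrite divr_gt0 ?ltr0n // lt0n size_eq0.
Qed.

Lemma cce_attained w : w != [::] -> exists u x,
  [/\ u \in conjugates w, infix x u, x != [::] & cce w = exponent x].
Proof.
move=> w0; have ww : w \in conjugates w.
  by apply/mem_conjugates; exists w, [::]; rewrite cats0.
have : (0 < cce w)%R.
  exact: lt_le_trans (exponent_gt0 w0) (cce_ge ww (infix_refl w) w0).
pose F u := \big[Num.max/0%R]_(x <- factors u | x != [::]) exponent x.
rewrite -[cce w]/(\big[Num.max/0%R]_(u <- conjugates w) F u).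
have [->|[u [uw _ ->]]] := bigmax_attained (conjugates w) predT F.
  by rewrite ltxx.
rewrite /F {F}.
case: (bigmax_attained (factors u) (fun x => x != [::]) exponent) => [->|].
  by rewrite ltxx.
by case=> x [xu x0 ->] _; exists u, x; rewrite -mem_factors.
Qed.

Lemma base2_value n : foldl (fun m (d : 'I_2) => m.*2 + d) 0 (base2 n) = n.
Proof.
rewrite /base2; suff H f m : m <= f ->
  foldl (fun m (d : 'I_2) => m.*2 + d) 0 (base2_rec f m) = m by exact: H.
elim: f m => [|f IH] [|m] //= le_mf; rewrite -cats1 foldl_cat IH /=.
  by rewrite modn2 /= -[RHS]odd_double_half /= addnC.
by rewrite -ltnS (leq_trans _ le_mf) // ltnS leq_uphalf_double -addnn leq_addr.
Qed.

Lemma base2_head n : 0 < n -> head ord0 (base2 n) = ord_max.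
Proof.
rewrite /base2; suff H f m : 0 < m <= f -> head ord0 (base2_rec f m) = ord_max.
  by move=> n0; rewrite H // n0 leqnn.
elim: f m => [|f IH] [|[|m]] //= le_mf; first by case: f {IH le_mf} => *; apply: val_inj.
rewrite headI /=; have : head ord0 (base2_rec f m./2.+1) = ord_max.
  rewrite IH //= -ltnS (leq_trans _ le_mf) // !ltnS leq_half_double.
  by rewrite -addnn -addnS leq_addr.
by case: base2_rec.
Qed.

(* Main.v *)
Require Import Defs.
From mathcomp Require Import all_boot all_order all_algebra.
From mathcomp Require Import finmap classical_sets.
From mathcomp Require Import zify.

(* A repetition in a conjugate of x = t[i..i+n) is a repetition of x ++ x of
   length at most n; since t is overlap-free, it has exponent > 2 only if it
   crosses the seam between the two copies of x.
   - n odd: t has no factor of length 4 occurring at positions of both parities,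
     and the parities on the two sides of the seam do not match.  This forces a
     crossing repetition of period p to have exponent at most 2 + 6 / p, whereas
     the ten letters on each side of the seam always contain exponent 7/3, so
     these letters determine cce x.
   - n = 2m, i even: x = mu y with y = t[i/2..i/2+m), and cce x = cce y.
   - n = 2m, i odd, t[i-1] = t[i+n-1]: x is a conjugate of such a mu y.
   - n = 2m, i odd, t[i] = t[i+n-1]: the square of letters at the seam is out of
     phase with mu, so again cce x is determined by ten letters on each side.
   Hence for n >= 20, ace n is the set of local exponents at the seam, together
   with ace (n / 2) if n is even.  The local exponents depend on n mod 16 and on
   the set of pairs (t[k..k+3), t[k+q..k+q+3)) for q = n / 16, and this set for
   2q + b is a function of the one for q.  The theorem then follows by checking
   an invariant of finitely many configurations. *)

Set Implicit Arguments.
Unset Strict Implicit.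
Unset Printing Implicit Defensive.

Import Order.TTheory GRing.Theory Num.Theory.

(** * Factors of the Thue-Morse word *)

Local Notation t := thue_morse.

Lemma thue_morse_bit n (b : bool) : t (n.*2 + b) = t n (+) b.
Proof.
have lt_n : n.*2 + b < n.+1.*2 by case: b; lia.
rewrite -[LHS](@nth_mkseq _ false t n.+1.*2) // -thue_morse_fixed.
rewrite nth_mu ?size_mkseq //.
have -> : (n.*2 + b)./2 = n by rewrite addnC half_bit_double.
by rewrite nth_mkseq // oddD odd_double oddb addbC.
Qed.

Lemma thue_morse_double n : t n.*2 = t n.
Proof. by have := thue_morse_bit n false; rewrite addn0 addbF. Qed.

Lemma thue_morse_doubleS n : t n.*2.+1 = ~~ t n.
Proof. by have := thue_morse_bit n true; rewrite addn1 addbT. Qed.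

Lemma thue_morse_pair n : ~~ odd n -> t n.+1 = ~~ t n.
Proof.
by move=> /even_halfK <-; rewrite thue_morse_doubleS thue_morse_double.
Qed.

(** Of two adjacent pairs of letters, one starts at an even position; it is the image of a letter
    under [mu], so its letters differ. *)
Lemma thue_morse_cube_free n : ~ (t n = t n.+1 /\ t n.+1 = t n.+2).
Proof.
case=> e1 e2; case: (boolP (odd n)) => odd_n.
  have := @thue_morse_pair n.+1; rewrite /= odd_n -e2 => /(_ isT).
  by case: (t n.+1).
by have := thue_morse_pair odd_n; rewrite -e1; case: (t n).
Qed.

(** For [i] even and [j] odd, the pairs starting at [i], [j + 1] and [i + 2] are images of letters,
    so the common block alternates. At the odd occurrence this makes three consecutive preimage
    letters equal, a cube. *)
Lemma thue_morse_parity i j : odd i != odd j ->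
  ~ (forall k, k < 4 -> t (i + k) = t (j + k)).
Proof.
wlog odd_j : i j / odd j.
  move=> H ij; case: (boolP (odd j)) => [oj|ej]; first exact: H.
  have oi : odd i by case: (odd i) ij ej => //; case: (odd j).
  by move=> e; apply: (H j i oi); [rewrite eq_sym | move=> k /e].
rewrite odd_j => even_i e.
have {}even_i : ~~ odd i by case: (odd i) even_i.
have := (e 0 isT, e 1 isT, e 2 isT, e 3 isT).
rewrite -(even_halfK even_i) -{1 2 3 4}(odd_double_half j) odd_j.
set a := i./2; set b := j./2.
have -> : true + b.*2 + 0 = b.*2.+1 by lia.
have -> : true + b.*2 + 1 = b.+1.*2 by lia.
have -> : true + b.*2 + 2 = b.+1.*2.+1 by lia.
have -> : true + b.*2 + 3 = b.+2.*2 by lia.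
have -> : a.*2 + 0 = a.*2 by lia.
have -> : a.*2 + 1 = a.*2.+1 by lia.
have -> : a.*2 + 2 = a.+1.*2 by lia.
have -> : a.*2 + 3 = a.+1.*2.+1 by lia.
rewrite !thue_morse_doubleS !thue_morse_double => -[[[e0 e1] e2] e3].
apply: (@thue_morse_cube_free b).
move: e0 e1 e2 e3; case: (t a); case: (t a.+1); case: (t b);
  by case: (t b.+1); case: (t b.+2).
Qed.

(** Descent on the period: an odd period other than 1 would repeat four letters at positions of both
    parities, and an even one can be halved. *)
Lemma thue_morse_overlap_free i p : 0 < p ->
  ~ (forall j, j <= p -> t (i + j) = t (i + j + p)).
Proof.
elim/ltn_ind: p i => p IH i p0 e; case: (boolP (odd p)) => odd_p.
  case: (eqVneq p 1) => [p1|pn1].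
    apply: (@thue_morse_cube_free i); split.
      by have := e 0 isT; rewrite p1 addn0 addn1.
    by have := e 1; rewrite p1 !addn1; apply.
  apply: (@thue_morse_parity i (i + p)).
    by rewrite oddD odd_p; case: (odd i).
  move=> k k4; rewrite [RHS](_ : _ = t (i + k + p)); last by congr t; lia.
  by apply: e; lia.
have q : p = p./2.*2 by rewrite even_halfK.
apply: (IH p./2 _ i./2); [lia | lia | move=> j jp].
have := e j.*2 ltac:(lia).
have -> : i + j.*2 = (i./2 + j).*2 + odd i by lia.
have -> : (i./2 + j).*2 + odd i + p = (i./2 + j + p./2).*2 + odd i by lia.
by rewrite !thue_morse_bit => /addIb.
Qed.

(** Letters 0 and 3 of the word are both 0, so their [k]-fold images under [mu] coincide. *)
Lemma thue_morse_shift k j : j < 2 ^ k -> t (3 * 2 ^ k + j) = t j.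
Proof.
elim: k j => [|k IH] j; first by case: j.
rewrite expnS => jk; rewrite -(odd_double_half j).
have -> : 3 * (2 * 2 ^ k) + (odd j + j./2.*2)
        = (3 * 2 ^ k + j./2).*2 + odd j by lia.
by rewrite thue_morse_bit IH ?[odd j + _]addnC ?thue_morse_bit //; lia.
Qed.

(** The letters at [2a + 1] and [2a + 2] are equal exactly when [t a] and [t (a + 1)] differ;
    otherwise cube-freeness makes [t (a + 1)] and [t (a + 2)] differ. *)
Lemma thue_morse_square i : exists2 j, j < 4 & t (i + j) = t (i + j).+1.
Proof.
pose a := i./2; pose o := nat_of_bool (~~ odd i).
have E0 : i + o = a.*2.+1 by rewrite /o /a; case: (boolP (odd i)) => /=; lia.
case: (eqVneq (t a) (t a.+1)) => [e1|n1]; last first.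
  exists o; first by rewrite /o; case: odd.
  rewrite E0 -doubleS thue_morse_doubleS thue_morse_double.
  by case: (t a) n1; case: (t a.+1).
exists (o + 2); first by rewrite /o; case: odd.
rewrite addnA E0 addn2 -doubleS -[a.+1.*2.+2]doubleS.
rewrite thue_morse_doubleS thue_morse_double.
have := @thue_morse_cube_free a; rewrite e1.
by case: (t a.+1); case: (t a.+2) => // H; case: H.
Qed.

Definition tw (i l : nat) : seq bool := mkseq (fun j => thue_morse (i + j)) l.

Definition sub (a l : nat) (w : seq bool) : seq bool := take l (drop a w).

Lemma size_tw i l : size (tw i l) = l.
Proof. exact: size_mkseq. Qed.

Lemma nth_tw i l j : j < l -> nth false (tw i l) j = t (i + j).
Proof. by move=> jl; rewrite nth_mkseq. Qed.

Lemma tw_eqP i j l :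
  (forall k, k < l -> t (i + k) = t (j + k)) <-> tw i l = tw j l.
Proof.
split=> [e|e k kl]; last by rewrite -!(@nth_tw _ l) // e.
apply: (@eq_from_nth _ false); rewrite ?size_tw // => k kl.
by rewrite !nth_tw ?e.
Qed.

Lemma sub_tw a l i m : a + l <= m -> sub a l (tw i m) = tw (i + a) l.
Proof.
move=> alm; apply: (@eq_from_nth _ false).
  by rewrite /sub size_takel ?size_drop size_tw //; lia.
move=> k; rewrite /sub size_takel ?size_drop ?size_tw; last lia.
move=> kl; rewrite nth_take // nth_drop !nth_tw; try lia.
by rewrite addnA.
Qed.

Lemma mu_tw i l : mu (tw i l) = tw i.*2 l.*2.
Proof.
apply: (@eq_from_nth _ false); first by rewrite size_mu !size_tw.
move=> k; rewrite size_mu size_tw => kl.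
rewrite nth_mu ?size_tw // !nth_tw //; last lia.
have -> : i.*2 + k = (i + k./2).*2 + odd k by lia.
by rewrite thue_morse_bit addbC.
Qed.

Lemma iter_mu_tw n i l : iter n mu (tw i l) = tw (2 ^ n * i) (2 ^ n * l).
Proof.
elim: n => [|n IH]; first by rewrite !mul1n.
by rewrite iterS IH mu_tw -!mul2n !mulnA -expnS.
Qed.

(** Later, windows start ten letters before a position; this supplies an occurrence with that room
    on its left and the same parity. *)
Lemma thue_morse_recurrent i n :
  exists i', [/\ 10 <= i', odd i' = odd i & tw i' n = tw i n].
Proof.
pose k := (i + n).+4; have lt_k : (i + n).+4 < 2 ^ k by exact: ltn_expl.
have ev : odd (3 * 2 ^ k) = false by rewrite oddM oddX.
have le16 : 2 ^ 4 <= 2 ^ k by rewrite leq_exp2l // /k; lia.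
exists (3 * 2 ^ k + i); split; first by lia.
  by rewrite oddD ev.
by apply/tw_eqP => j jn; rewrite -addnA thue_morse_shift //; lia.
Qed.

(** * Repetitions and the circular critical exponent *)

(** The period [p] need not be the least one: [L / p] is then a lower bound for the exponent, and
    the maximum over all repetitions stays the same. *)
Definition srep (y : seq bool) (s L p : nat) : Prop :=
  [/\ 0 < p <= L, s + L <= size y &
      forall j, j + p < L ->
        nth false y (s + j) = nth false y (s + j + p)].

Definition fac_le (c d : nat * nat) : bool := c.1 * d.2 <= d.1 * c.2.

Fixpoint maxrun (e : seq bool) : nat :=
  if e is _ :: e' then maxn (find negb e) (maxrun e') else 0.

Lemma maxrun_attained e : exists2 j, j + maxrun e <= size e &
  forall k, k < maxrun e -> nth false e (j + k).
Proof.
elim: e => [|b e [j je He]] /=; first by exists 0.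
case: leqP => h; first by exists j.+1.
exists 0; first by rewrite (find_size negb (b :: e)).
move=> k kl; have := @before_find _ false negb (b :: e) k kl.
by move/negbFE.
Qed.

Lemma maxrun_max e j m : j + m <= size e ->
  (forall k, k < m -> nth false e (j + k)) -> m <= maxrun e.
Proof.
elim: e j => [|b e IH] j; first by move=> /= ms _; lia.
case: j => [|j] ms H /=; rewrite leq_max; last by rewrite (IH j) ?orbT.
apply/orP; left; rewrite leqNgt; apply/negP => lt_m.
have hasn : has negb (b :: e) by rewrite has_find; apply: leq_trans lt_m ms.
by have := nth_find false hasn; rewrite [nth _ _ _](H _ lt_m).
Qed.

Definition matches (y : seq bool) (p : nat) : seq bool :=
  [seq eqb ab.1 ab.2 | ab <- zip y (drop p y)].

Lemma size_matches y p : size (matches y p) = size y - p.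
Proof. by rewrite size_map size_zip size_drop; lia. Qed.

Lemma nth_matches y p k : k + p < size y ->
  nth false (matches y p) k = (nth false y k == nth false y (k + p)).
Proof.
move=> kp; rewrite (nth_map (false, false)) ?size_zip ?size_drop; last by lia.
rewrite nth_zip_cond /= size_zip size_drop [_ < _](_ : _ = true); last by lia.
by rewrite nth_drop addnC.
Qed.

(** The largest exponent with length at most [cap] and period at most [pmax]. Fractions are pairs of
    naturals compared by cross-multiplication, for the sake of computation; [(1, 1)] stands for a
    single letter. *)
Definition best (y : seq bool) (cap pmax : nat) : nat * nat :=
  foldr (fun p c => let d := (minn cap (p + maxrun (matches y p)), p) in
                    if fac_le d c then c else d)
        (1, 1) (iota 1 pmax).

Lemma fac_le_trans c d e : 0 < d.2 -> fac_le c d -> fac_le d e -> fac_le c e.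
Proof. by rewrite /fac_le => d0 cd de; nia. Qed.

Lemma fac_le_total c d : ~~ fac_le c d -> fac_le d c.
Proof. by rewrite /fac_le; lia. Qed.

Lemma best_den_gt0 y cap pmax : 0 < (best y cap pmax).2.
Proof.
rewrite /best; have : all (leq 1) (iota 1 pmax).
  by apply/allP => p; rewrite mem_iota; lia.
elim: (iota 1 pmax) => //= p l IH /andP[p0 /IH h].
by case: ifP.
Qed.

Lemma best_ge y cap pmax s L p : srep y s L p -> L <= cap -> p <= pmax ->
  fac_le (L, p) (best y cap pmax).
Proof.
case=> /andP[p0 pL] sL H Lcap pmaxp.
have : p \in iota 1 pmax by rewrite mem_iota; lia.
have run : L - p <= maxrun (matches y p).
  apply: (@maxrun_max _ s); first by rewrite size_matches; lia.
  move=> k kL; rewrite nth_matches; last by lia.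
  by rewrite H //; lia.
rewrite /best; set f := fun _ _ => _.
have : all (leq 1) (iota 1 pmax).
  by apply/allP => q; rewrite mem_iota; lia.
have den l : all (leq 1) l -> 0 < (foldr f (1, 1) l).2.
  by elim: l => //= q l IH /andP[q0 /IH h]; rewrite {1}/f; case: ifP.
elim: (iota 1 pmax) => //= q l IH /andP[q0 l0]; rewrite inE => /predU1P[<-|pl].
  rewrite /f /=; set d := (minn _ _, _); set c := foldr _ _ _.
  have Ld : fac_le (L, p) d by rewrite /fac_le /d /=; nia.
  by case: ifP => // dc; apply: fac_le_trans dc.
have := IH l0 pl; rewrite {2}/f; case: ifPn => // dc h.
by apply: fac_le_trans h (fac_le_total dc); apply: den.
Qed.

Lemma best_attained y cap pmax : 0 < cap -> pmax <= cap -> cap <= size y ->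
  exists s, srep y s (best y cap pmax).1 (best y cap pmax).2
    /\ (best y cap pmax).1 <= cap /\ (best y cap pmax).2 <= maxn 1 pmax.
Proof.
move=> cap0 le_pmax le_cap; rewrite /best.
have : all (fun p => 1 <= p <= pmax) (iota 1 pmax).
  by apply/allP => p; rewrite mem_iota; lia.
elim: (iota 1 pmax) => [|p l IH] /=.
  move=> _; exists 0; split; last by rewrite leq_maxl.
  by split=> //= [|j]; lia.
case/andP=> /andP[p0 pp] /IH {}IH; case: ifP => // _ {IH} /=.
have [j js jH] := maxrun_attained (matches y p).
move: js jH; rewrite size_matches => js jH.
exists j; split; last by split; rewrite ?geq_minl // leq_max pp orbT.
split; [lia | lia | move=> k kL].
have kr : k < maxrun (matches y p) by lia.
by have := jH k kr; rewrite nth_matches; [move/eqP | lia].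
Qed.

Definition ratio (c : nat * nat) : rat := (c.1%:R / c.2%:R)%R.

Lemma ratio_le c d : 0 < c.2 -> 0 < d.2 -> (ratio c <= ratio d)%R = fac_le c d.
Proof.
move=> c0 d0; rewrite /ratio ler_pdivrMr ?ltr0n // mulrAC.
by rewrite ler_pdivlMr ?ltr0n // -!natrM ler_nat.
Qed.

Lemma size_gt0_neq_nil (w : seq bool) : 0 < size w -> w != [::].
Proof. by case: w. Qed.

Lemma period_srep (w : seq bool) : w != [::] -> srep w 0 (size w) (period w).
Proof.
move=> w0; have [/andP[pw /allP H] _] := periodP w0.
split=> // j jp; rewrite !add0n; apply/eqP/H; rewrite mem_iota; lia.
Qed.

Lemma srep_period_le y s L p : srep y s L p ->
  size (sub s L y) = L /\ period (sub s L y) <= p.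
Proof.
case=> /andP[p0 pL] sL H.
have sz : size (sub s L y) = L by rewrite size_takel ?size_drop; lia.
split=> //; have w0 : sub s L y != [::].
  by apply: size_gt0_neq_nil; rewrite sz; lia.
apply: (periodP w0).2; rewrite /is_period sz p0 pL /=.
apply/allP => j; rewrite mem_iota => jp.
by rewrite !nth_take ?nth_drop ?addnA ?H //; lia.
Qed.

(** A factor of [x ++ x] of length at most [size x] is a prefix of [rot s x], or lies in the second
    copy of [x]. *)
Lemma cce_ge_srep x s L p : srep (x ++ x) s L p -> L <= size x ->
  (ratio (L, p) <= cce x)%R.
Proof.
move=> rep Lx; have [sz per] := srep_period_le rep.
case: rep => /andP[p0 pL]; rewrite size_cat => sL _.
set z := sub s L (x ++ x) in sz per.
have z0 : z != [::] by apply: size_gt0_neq_nil; rewrite sz; lia.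
apply: (@le_trans _ _ (exponent z)).
  have [/andP[/andP[q0 _] _] _] := periodP z0.
  rewrite -[exponent z]/(ratio (size z, period z)) ratio_le // /fac_le sz /=.
  by nia.
suff [u uc zu] : exists2 u, u \in conjugates x & infix z u.
  exact: cce_ge zu z0.
have [sx|xs] := leqP s (size x).
  exists (rot s x).
    apply/mem_conjugates; exists (take s x), (drop s x).
    by rewrite cat_take_drop.
  apply/infixP; exists [::], (drop L (rot s x)); rewrite /z /sub drop_cat.
  have -> : (if s < size x then drop s x ++ x else drop (s - size x) x)
             = drop s x ++ x.
    case: ltnP => // xs; have -> : s = size x by lia.
    by rewrite subnn drop0 drop_size.
  have -> : take L (drop s x ++ x) = take L (rot s x).
    by rewrite -{2}(cat_take_drop s x) catA takel_cat // size_rot.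
  by rewrite /= cat_take_drop.
exists x; first by apply/mem_conjugates; exists x, [::]; rewrite cats0.
rewrite /z /sub drop_cat ltnNge ltnW //=.
apply/infixP; exists (take (s - size x) x), (drop L (drop (s - size x) x)).
by rewrite !cat_take_drop.
Qed.

Lemma srep_infix (u z v : seq bool) s L p :
  srep z s L p -> srep (u ++ z ++ v) (size u + s) L p.
Proof.
case=> pL sL H; split=> [//||j jL]; first by rewrite !size_cat; lia.
have mid k : k < size z ->
    nth false (u ++ z ++ v) (size u + k) = nth false z k.
  by move=> kz; rewrite nth_cat ltnNge leq_addr addKn nth_cat kz.
by rewrite -!addnA !mid ?addnA ?H //; lia.
Qed.

(** If [x = y1 ++ y2], then the conjugate [y2 ++ y1] sits in the middle of [x ++ x]. *)
Lemma cce_srep_attained (x : seq bool) : x != [::] -> exists s L p,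
  [/\ srep (x ++ x) s L p, L <= size x & cce x = ratio (L, p)].
Proof.
move=> x0; have [u [z [uc zu z0 ->]]] := cce_attained x0.
have /mem_conjugates[y1 [y2 [Ex Eu]]] := uc.
have /infixP[A [B Ez]] := zu.
have Exx : x ++ x = (y1 ++ A) ++ z ++ (B ++ y2).
  by rewrite Ex -!catA; congr (_ ++ _); rewrite !catA -Eu Ez -!catA.
exists (size (y1 ++ A) + 0), (size z), (period z); split=> //.
  by rewrite Exx; apply/srep_infix/period_srep.
have := congr1 size Ez; rewrite Eu Ex !size_cat addnC => ->.
by rewrite addnCA leq_addr.
Qed.

Lemma cce_srep x s L p : srep (x ++ x) s L p -> L <= size x ->
  (forall s' L' p', srep (x ++ x) s' L' p' -> L' <= size x ->
     fac_le (L', p') (L, p)) ->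
  cce x = ratio (L, p).
Proof.
move=> rep Lx H; apply/eqP; rewrite eq_le (cce_ge_srep rep Lx) andbT.
have [/andP[p0 pL] _ _] := rep.
have x0 : x != [::] by apply: size_gt0_neq_nil; lia.
have [s' [L' [p' [rep' Lx' ->]]]] := cce_srep_attained x0.
by rewrite ratio_le //=; [apply: H rep' Lx' | case: rep' => /andP[]].
Qed.

Lemma cce_best (x : seq bool) : x != [::] ->
  cce x = ratio (best (x ++ x) (size x) (size x)).
Proof.
move=> x0; have sx : 0 < size x by rewrite lt0n size_eq0.
have le2 : size x <= size (x ++ x) by rewrite size_cat leq_addr.
have [s [rep [L1 _]]] := best_attained sx (leqnn _) le2.
rewrite (cce_srep rep L1) => [|s' L' p' rep' Lx']; first by case: best.
have [/andP[p0 pL] _ _] := rep'.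
by rewrite -surjective_pairing; apply: (best_ge rep' Lx'); lia.
Qed.

Lemma cce_rot k (x : seq bool) : cce (rot k x) = cce x.
Proof.
have [-> //|x0] := eqVneq x [::].
have le k' y : y != [::] -> (cce (rot k' y) <= cce y)%R.
  move=> y0; have ry0 : rot k' y != [::] by rewrite -size_eq0 size_rot size_eq0.
  have [u [z [/mapP[i _ Eu] zu z0 ->]]] := cce_attained ry0.
  apply: cce_ge zu z0; rewrite {}Eu.
  apply/mem_conjugates.
  have [m ->] : exists m, rot i (rot k' y) = rot m y.
    have [ki|ki] := leqP (size y) i.
      by exists k'; rewrite rot_oversize // size_rot.
    have [kk|kk] := leqP (size y) k'.
      by exists i; rewrite (rot_oversize kk).
    by eexists; apply: rot_add_mod; apply: ltnW.
  by exists (take m y), (drop m y); rewrite cat_take_drop.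
(* For the reverse inequality, [x] is itself a rotation of [rot k x]. *)
apply/eqP; rewrite eq_le le //= -{1}(rotK k x) /rotr.
by apply: le; rewrite -size_eq0 size_rot size_eq0.
Qed.

(** * Invariance under the morphism *)

Lemma srep_mu y s L p : srep y s L p -> srep (mu y) s.*2 L.*2 p.*2.
Proof.
case=> pL sL H; split=> [||j jL]; [lia | by rewrite size_mu; lia |].
rewrite !nth_mu; try lia.
have -> : (s.*2 + j)./2 = s + j./2 by lia.
have -> : (s.*2 + j + p.*2)./2 = s + j./2 + p by lia.
by rewrite H; [rewrite !oddD !odd_double !addbF | lia].
Qed.

(** In [mu y], pairs starting at even positions have distinct letters. If [L > 2p], any other pair
    in the repetition moves to an even position by a shift of [p] to the left or right, so the
    repetition alternates; but an alternating word has no odd period. *)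
Lemma srep_mu_odd y s L p : srep (mu y) s L p -> odd p -> L <= p.*2.
Proof.
case=> _ sL H odd_p; rewrite leqNgt; apply/negP => ltL; rewrite size_mu in sL.
have pair k : k.+1 < (size y).*2 -> ~~ odd k ->
    nth false (mu y) k.+1 = ~~ nth false (mu y) k.
  move=> ky ek; rewrite !nth_mu; try lia.
  have -> : k.+1./2 = k./2 by lia.
  by rewrite /= ek (negbTE ek).
have alt j : j.+1 < L ->
    nth false (mu y) (s + j.+1) = ~~ nth false (mu y) (s + j).
  move=> jL; rewrite addnS; case: (boolP (odd (s + j))) => [o|]; last first.
    by apply: pair; lia.
  have [pj|jp] := leqP p j.
    have e1 := H (j - p) ltac:(lia); have e2 := H (j - p).+1 ltac:(lia).
    have E1 : s + (j - p) + p = s + j by lia.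
    have E2 : s + (j - p).+1 + p = (s + j).+1 by lia.
    rewrite -E2 -e2 -E1 -e1 addnS; apply: pair; [lia|].
    by move: o; rewrite -E1 oddD odd_p; case: odd.
  have e1 := H j ltac:(lia); have e2 := H j.+1 ltac:(lia).
  rewrite -addnS e1 e2 addnS addSn; apply: pair; [lia|].
  by rewrite oddD o odd_p.
have parity j : j < L ->
    nth false (mu y) (s + j) = odd j (+) nth false (mu y) s.
  elim: j => [|j IH] jL; first by rewrite addn0.
  by rewrite alt // IH ?(ltnW jL) //= addNb.
have := H 0 ltac:(lia).
by rewrite addn0 parity ?odd_p; [case: nth | lia].
Qed.

Lemma srep_mu_half y s L p : srep (mu y) s L p.*2 -> p.*2 < L ->
  exists2 L', srep y s./2 L' p & L <= L'.*2.
Proof.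
case=> pL sL H ltL; rewrite size_mu in sL.
(* This counts the letters of [y] whose two-letter images meet the repetition: one letter of an
   image already determines its preimage. *)
exists ((s + L).-1./2 - s./2).+1; last by lia.
split=> [||j jL]; [lia | lia |].
(* For [j = 0] and [s] odd, the truncated subtraction gives 0, the second letter of the first
   image. *)
have := H (j.*2 - odd s) ltac:(lia); rewrite !nth_mu; try lia.
have -> : (s + (j.*2 - odd s))./2 = s./2 + j by lia.
have -> : (s + (j.*2 - odd s) + p.*2)./2 = s./2 + j + p by lia.
by rewrite [odd (_ + p.*2)]oddD odd_double addbF => /addbI.
Qed.

Lemma srep_take y s L L' p : srep y s L p -> p <= L' <= L -> srep y s L' p.
Proof. by case=> pL sL H le; split=> [||j jL]; [lia | lia | apply: H; lia]. Qed.

(** The square makes the maximum at least 2, so only repetitions of [mu x] of exponent above 2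
    matter; their periods are even, and they come from repetitions of [x ++ x]. *)
Lemma cce_mu (x : seq bool) s p : srep (x ++ x) s p.*2 p -> p.*2 <= size x ->
  cce (mu x) = cce x.
Proof.
move=> sq px; have [/andP[p0 _] _ _] := sq.
have x0 : x != [::] by apply: size_gt0_neq_nil; lia.
have [s1 [L1 [p1 [rep1 Lx1 E1]]]] := cce_srep_attained x0.
have [/andP[p1_gt0 _] _ _] := rep1.
have max1 s' L' p' : srep (x ++ x) s' L' p' -> L' <= size x ->
    fac_le (L', p') (L1, p1).
  move=> rep' L'x; have [/andP[p'0 _] _ _] := rep'.
  by rewrite -ratio_le // -E1; apply: cce_ge_srep rep' L'x.
have ge2 : p1.*2 <= L1 by have := max1 _ _ _ sq px; rewrite /fac_le /=; nia.
have -> : cce x = ratio (L1.*2, p1.*2).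
  apply/eqP; rewrite E1 eq_le !ratio_le /fac_le //=; lia.
apply: (@cce_srep _ s1.*2); first by rewrite -mu_cat; apply: srep_mu.
  by rewrite size_mu; lia.
move=> s' L' p'; rewrite -mu_cat size_mu => rep' L'x.
have [/andP[p'0 pL'] _ _] := rep'.
have [small|big] := leqP L' p'.*2; first by rewrite /fac_le /=; nia.
case: (boolP (odd p')) => [o|e].
  by have := srep_mu_odd rep' o; lia.
rewrite -(even_halfK e) in rep'.
have [L2 rep2 L2ge] := srep_mu_half rep' ltac:(lia).
have [/andP[_ pL2] _ _] := rep2.
(* The preimage may be longer than [size x], so it is truncated; the bound [L' <= 2 * size x] keeps
   the exponent large enough. *)
have := max1 _ _ _ (@srep_take _ _ _ (minn L2 (size x)) _ rep2 ltac:(lia))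
             ltac:(lia).
have [q ->] : exists q, p' = q.*2 by exists p'./2; rewrite even_halfK.
by rewrite doubleK /fac_le /=; nia.
Qed.

(** * Repetitions crossing the seam *)

Lemma srep_infix_inv (u z v : seq bool) s L p :
  srep (u ++ z ++ v) (size u + s) L p -> s + L <= size z -> srep z s L p.
Proof.
case=> pL _ H sL; split=> [//|//|j jL].
have mid k : k < size z ->
    nth false (u ++ z ++ v) (size u + k) = nth false z k.
  by move=> kz; rewrite nth_cat ltnNge leq_addr addKn nth_cat kz.
by have := H j jL; rewrite -!addnA !mid ?addnA //; lia.
Qed.

Lemma tw_cat i a b : tw i (a + b) = tw i a ++ tw (i + a) b.
Proof.
apply: (@eq_from_nth _ false); first by rewrite size_cat !size_tw.
move=> k; rewrite size_tw => kab; rewrite nth_cat size_tw.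
by case: ltnP => ka; rewrite !nth_tw //; [congr t; lia | lia].
Qed.

Definition seam_window K i n := tw (i + n - K) K ++ tw i K.

Lemma tw_seam K i n : K <= n ->
  tw i n ++ tw i n = tw i (n - K) ++ seam_window K i n ++ tw (i + K) (n - K).
Proof.
move=> Kn; rewrite /seam_window -[in X in X ++ _](subnK Kn) tw_cat.
rewrite -[in X in _ ++ X](subnKC Kn) tw_cat -!catA.
by rewrite addnBA.
Qed.

Lemma thue_morse_period_le c L p : 0 < p ->
  (forall j, j + p < L -> t (c + j) = t (c + j + p)) -> L <= p.*2.
Proof.
move=> p0 H; rewrite leqNgt; apply/negP => ltL.
by apply: (@thue_morse_overlap_free c p) => // j jp; apply: H; lia.
Qed.

Lemma thue_morse_run_le c d m : odd c != odd d ->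
  (forall j, j < m -> t (c + j) = t (d + j)) -> m <= 3.
Proof.
move=> cd H; rewrite leqNgt; apply/negP => ltm.
by apply: (thue_morse_parity cd) => k k4; apply: H; lia.
Qed.

Lemma nth_tw_tw i n k : k < n.*2 ->
  nth false (tw i n ++ tw i n) k = if k < n then t (i + k) else t (i + (k - n)).
Proof.
by move=> kn; rewrite nth_cat size_tw; case: ltnP => h; rewrite nth_tw //; lia.
Qed.

Section Crossing.
Variables (i n s L p : nat).
Hypothesis rep : srep (tw i n ++ tw i n) s L p.
Hypothesis ltpL : p.*2 < L.
(** When the repetition crosses the seam, [a] and [b] count its letters to the left and to the right
    of it. *)
Local Notation a := (n - s).
Local Notation b := (s + L - n).

(** Otherwise the repetition would be a factor of [t] with exponent above 2. *)
Lemma crossing : s < n < s + L.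
Proof.
have [/andP[p0 pL] + H] := rep; rewrite size_cat !size_tw => sL.
apply/andP; split; rewrite ltnNge; apply/negP => h.
  suff : L <= p.*2 by lia.
  apply: (@thue_morse_period_le (i + s - n)) => // j jL.
  have := H j jL; rewrite !nth_tw_tw; try lia.
  rewrite !ifF; try lia.
  by congr (t _ = t _); lia.
suff : L <= p.*2 by lia.
apply: (@thue_morse_period_le (i + s)) => // j jL.
have := H j jL; rewrite !nth_tw_tw; try lia.
by rewrite !ifT; try lia; congr (t _ = t _); lia.
Qed.

Lemma crossing_left j : j + p < a -> t (i + s + j) = t (i + s + j + p).
Proof.
have cr := crossing.
have [_ + H] := rep; rewrite size_cat !size_tw => sL ja.
have := H j ltac:(lia); rewrite !nth_tw_tw; try lia.
by rewrite !ifT; try lia; congr (t _ = t _); lia.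
Qed.

Lemma crossing_right j : j + p < b -> t (i + j) = t (i + j + p).
Proof.
have cr := crossing.
have [_ + H] := rep; rewrite size_cat !size_tw => sL jb.
have := H (a + j) ltac:(lia); rewrite !nth_tw_tw; try lia.
by rewrite !ifF; try lia; congr (t _ = t _); lia.
Qed.

Lemma crossing_mid j : j < a -> a <= j + p < L ->
  t (i + s + j) = t (i + (j + p - a)).
Proof.
have cr := crossing.
have [_ + H] := rep; rewrite size_cat !size_tw => sL ja jL.
have := H j ltac:(lia); rewrite !nth_tw_tw; try lia.
by rewrite ifT ?ifF; try lia; congr (t _ = t _); lia.
Qed.

(** The first two bounds are overlap-freeness on each side. In the other two, blocks of [t] at an
    odd distance agree, hence have at most 3 letters: the distance is [p] within one side, and has
    the parity of [n - p] when the seam lies between the blocks. *)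
Lemma crossing_bounds :
  [/\ a <= p.*2, b <= p.*2, odd p -> a <= p + 3 /\ b <= p + 3
    & odd p != odd n -> minn a (L - p) - (a - p) <= 3].
Proof.
have [/andP[p0 pL] _ _] := rep; have cr := crossing.
split.
- exact: thue_morse_period_le p0 crossing_left.
- exact: thue_morse_period_le p0 crossing_right.
- move=> o; suff : a - p <= 3 /\ b - p <= 3 by lia.
  split.
    apply: (@thue_morse_run_le (i + s) (i + s + p)).
      by rewrite [odd (_ + p)]oddD o; case: odd.
    by move=> j ja; rewrite crossing_left; [congr t; lia | lia].
  apply: (@thue_morse_run_le i (i + p)).
    by rewrite [odd (_ + p)]oddD o; case: odd.
  by move=> j ja; rewrite crossing_right; [congr t; lia | lia].
- move=> pn.
  apply: (@thue_morse_run_le (i + s + (a - p)) (i + (a - p + p - a))).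
    by lia.
  by move=> j jm; rewrite -addnA crossing_mid; [congr t; lia | lia | lia].
Qed.

(** In every case [L <= 2 * p + 6], which is at most [7 * p / 3] from [p = 18] on. The bound 20 is
    [p + 3] for [p = 17]. *)
Lemma crossing_odd : odd n -> 7 * p < 3 * L -> [/\ a <= 20, b <= 20 & p <= 17].
Proof.
move=> on big; have [h1 h2 h3 h4] := crossing_bounds; have cr := crossing.
case: (boolP (odd p)) h3 h4 => op h3 h4.
  by have h5 := h3 isT; split; lia.
by have h5 := h4 ltac:(lia); split; lia.
Qed.

(* The two equal letters on either side of the seam start at an odd position,
   and an even period would copy them to an even position of t. *)
Lemma crossing_even : ~~ odd n -> odd i -> t i = t (i + n - 1) ->
  [/\ a <= 10, b <= 10 & p <= 7].
Proof.
move=> en oi dd; have [h1 h2 h3 h4] := crossing_bounds; have cr := crossing.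
have [/andP[p0 pL] _ _] := rep.
case: (boolP (odd p)) => op.
  by have h5 := h3 op; have h6 := h4 ltac:(lia); split; lia.
(* The period copies the pair around the seam [p] places to the left if [p < a], and [p] places to
   the right otherwise. *)
have {h1 h2 h3 h4}[pa|ap] := ltnP p a.
  have e1 := @crossing_left (a - p).-1 ltac:(lia).
  have e2 := @crossing_mid (a - p) ltac:(lia) ltac:(lia).
  have e3 := @thue_morse_pair (i + s + (a - p).-1) ltac:(lia).
  move: e3; rewrite (_ : (_ + _).+1 = i + s + (a - p)); last by lia.
  have E1 : i + s + (a - p).-1 + p = i + n - 1 by lia.
  have E2 : i + (a - p + p - a) = i by lia.
  by rewrite e1 e2 E1 E2 dd; case: t.
have e1 := @crossing_mid a.-1 ltac:(lia) ltac:(lia).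
have e2 := @crossing_right 0 ltac:(lia).
have := @thue_morse_pair (i + p - 1) ltac:(lia).
rewrite (_ : (_ - 1).+1 = i + 0 + p); last by lia.
rewrite -e2 addn0 dd (_ : i + p - 1 = i + (a.-1 + p - a)); last by lia.
rewrite -e1 (_ : i + n - 1 = i + s + a.-1); last by lia.
by case: t.
Qed.

End Crossing.

(** * Local exponents in finitely many windows around the seam *)

Definition factors3 : seq (seq bool) :=
  [:: [:: false; false; true]; [:: false; true; false];
      [:: false; true; true]; [:: true; false; false];
      [:: true; false; true]; [:: true; true; false]].

Lemma tw3_factors3 k : tw k 3 \in factors3.
Proof.
have := @thue_morse_cube_free k.
rewrite -[tw k 3]/[:: t (k + 0); t (k + 1); t (k + 2)] addn0 addn1 addn2.
by case: (t k); case: (t k.+1); case: (t k.+2) => // H; case: H.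
Qed.

Lemma factors3_tw u : u \in factors3 -> exists k, u = tw k 3.
Proof.
rewrite !inE => /or4P[|||/or3P[]] /eqP->;
  [by exists 5 | by exists 3 | by exists 0
  | by exists 4 | by exists 2 | by exists 1].
Qed.

(** Since [48 = 15 + 33], the image of three letters holds all windows of length at most 33 that
    start in its first 16 letters. *)
Lemma tw_block k a l : a + l <= 48 ->
  sub a l (iter 4 mu (tw k 3)) = tw (16 * k + a) l.
Proof. by move=> al; rewrite iter_mu_tw sub_tw. Qed.

Definition phase_factors (b : bool) : seq (seq bool) :=
  undup [seq sub a 20 (iter 4 mu u)
        | u <- factors3, a <- [seq a <- iota 0 16 | odd a == b]].

Lemma mem_phase_factors i : tw i 20 \in phase_factors (odd i).
Proof.
rewrite mem_undup; apply/allpairsP; exists (tw (i %/ 16) 3, i %% 16); split.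
- exact: tw3_factors3.
- by rewrite mem_filter mem_iota /=; apply/andP; split; lia.
- by rewrite /= tw_block; [congr (tw _ _); lia | lia].
Qed.

(** The cap 20 is the length of ten letters on each side, and 7 is the bound on periods from
    [crossing_even]. *)
Definition seam_exponent (w : seq bool * seq bool) : nat * nat :=
  best (w.1 ++ w.2) 20 7.

(** The bounds 40 and 17 are those of [crossing_odd]: the wider window must bring no larger exponent
    than the narrow one. *)
Definition seam_check (u v : seq bool) : bool :=
  let c := seam_exponent (sub 10 10 u, sub 0 10 v) in
  fac_le (7, 3) c && fac_le (best (u ++ v) 40 17) c.

(** For odd [n] the windows on the two sides start at positions of opposite parities; all such pairs
    of factors are tested, whatever their distance in [t]. *)
Lemma seam_check_phases :
  all (fun b => all (fun u => all (seam_check u) (phase_factors (~~ b)))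
                    (phase_factors b)) [:: false; true].
Proof. by vm_cast_no_check (erefl true). Qed.

Lemma seam_check_odd i n : 20 <= n -> odd n ->
  seam_check (tw (i + n - 20) 20) (tw i 20).
Proof.
move=> n20 on; have /allP/(_ (odd (i + n - 20))) := seam_check_phases.
have -> : odd (i + n - 20) \in [:: false; true] by case: odd.
move=> /(_ isT)/allP/(_ _ (mem_phase_factors _))/allP; apply.
by rewrite (_ : ~~ _ = odd i) ?mem_phase_factors //; lia.
Qed.

Definition seam_pair i n := (tw (i + n - 10) 10, tw i 10).

Lemma seam_exponent_srep i n : 20 <= n ->
  let c := seam_exponent (seam_pair i n) in
  exists s, srep (tw i n ++ tw i n) s c.1 c.2 /\ c.1 <= n.
Proof.
move=> n20 c.
have le20 : 20 <= size (seam_window 10 i n) by rewrite size_cat !size_tw.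
have [s [rep [c20 _]]] := @best_attained (seam_window 10 i n) 20 7 isT isT le20.
exists (n - 10 + s); split; last exact: leq_trans c20 n20.
rewrite (@tw_seam 10) ?(leq_trans _ n20) // -[X in X + s](size_tw i).
exact: srep_infix.
Qed.

Lemma srep_seam_window K i n s L p : K <= n -> n <= s + K -> s + L <= n + K ->
  srep (tw i n ++ tw i n) s L p -> srep (seam_window K i n) (s + K - n) L p.
Proof.
move=> Kn nsK sLK rep.
apply: (@srep_infix_inv (tw i (n - K)) _ (tw (i + K) (n - K))).
  rewrite -tw_seam // size_tw (_ : n - K + (s + K - n) = s) //; lia.
by rewrite size_cat !size_tw; lia.
Qed.

Lemma cce_odd i n : 20 <= n -> odd n ->
  cce (tw i n) = ratio (seam_exponent (seam_pair i n)).
Proof.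
move=> n20 on; have [s [rep Ln]] := @seam_exponent_srep i n n20.
have den := @best_den_gt0 (seam_window 10 i n) 20 7.
have /andP[] := @seam_check_odd i n n20 on.
rewrite !sub_tw // addn0 (_ : i + n - 20 + 10 = i + n - 10); last by lia.
rewrite -/(seam_pair i n) -/(seam_window 20 i n) => ge73 le20.
move: (seam_exponent _) (den : 0 < (seam_exponent (seam_pair i n)).2)
  rep Ln ge73 le20.
move=> [L p] /= p0 rep Ln ge73 le20.
apply: (cce_srep rep) => [|s' L' p' rep']; rewrite size_tw // => L'n.
(* Exponents up to 7/3 are dominated by the window; larger ones are confined near the seam. *)
have [small|big] := leqP (3 * L') (7 * p').
  by apply: fac_le_trans ge73 => //; rewrite /fac_le /=; lia.
have [/andP[p'0 _] _ _] := rep'.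
have ltL : p'.*2 < L' by lia.
have cr := crossing rep' ltL.
have [a20 b20 p17] := crossing_odd rep' ltL on big.
have [K20 sK LK] : [/\ 20 <= n, n <= s' + 20 & s' + L' <= n + 20].
  by split; lia.
have := @best_ge (seam_window 20 i n) 40 17 _ _ _
          (srep_seam_window K20 sK LK rep') ltac:(lia) p17.
by move=> h; exact: fac_le_trans (best_den_gt0 _ _ _) h le20.
Qed.

Lemma cce_even_seam i n : 20 <= n -> ~~ odd n -> odd i -> t i = t (i + n - 1) ->
  cce (tw i n) = ratio (seam_exponent (seam_pair i n)).
Proof.
move=> n20 en oi dd; have [s [rep Ln]] := @seam_exponent_srep i n n20.
have den := @best_den_gt0 (seam_window 10 i n) 20 7.
(* The two equal letters at the seam, at places 9 and 10 of the window, form a square of period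
   1. *)
have ge2 : fac_le (2, 1) (seam_exponent (seam_pair i n)).
  apply: (@best_ge _ _ _ 9) => //; split=> // j j1.
  have {j1}-> : j = 0 by lia.
  rewrite -/(seam_window 10 i n) !nth_cat !size_tw.
  rewrite -[LHS]/(nth false (tw (i + n - 10) 10) 9).
  by rewrite -[RHS]/(nth false (tw i 10) 0) !nth_tw // addn0 dd; congr t; lia.
have max10 s' L' p' : srep (tw i n ++ tw i n) s' L' p' -> p'.*2 < L' ->
    fac_le (L', p') (seam_exponent (seam_pair i n)).
  move=> rep' ltL; have cr := crossing rep' ltL.
  have [a10 b10 p7] := crossing_even rep' ltL en oi dd.
  have [K10 sK LK] : [/\ 10 <= n, n <= s' + 10 & s' + L' <= n + 10].
    by split; lia.
  by apply: (@best_ge (seam_window 10 i n) 20 7 _ _ _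
               (srep_seam_window K10 sK LK rep')); lia.
move: (seam_exponent _) (den : 0 < (seam_exponent (seam_pair i n)).2)
  rep Ln ge2 max10.
move=> [L p] /= p0 rep Ln ge2 max10.
apply: (cce_srep rep) => [|s' L' p' rep']; rewrite size_tw // => L'n.
have [small|] := leqP L' p'.*2; last exact: max10 rep'.
by apply: fac_le_trans ge2 => //; rewrite /fac_le /=; lia.
Qed.

(** Five letters always contain the square of a letter that [cce_mu] asks for. *)
Lemma cce_double i m : 5 <= m -> cce (tw i.*2 m.*2) = cce (tw i m).
Proof.
move=> m5; rewrite -mu_tw; have [j j4 e] := thue_morse_square i.
apply: (@cce_mu _ j 1); last by rewrite size_tw; lia.
split=> // [|k k1]; first by rewrite size_cat !size_tw; lia.
have {k k1}-> : k = 0 by lia.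
by rewrite !nth_tw_tw ?addn0 ?addn1 ?ifT ?e ?addnS //; lia.
Qed.

(** The letter gained on the right equals the letter [t (2 * i)] lost on the left, so the word is a
    rotation of the one starting at [2 * i]. *)
Lemma cce_double_odd i m : 5 <= m -> t i = t (i + m) ->
  cce (tw i.*2.+1 m.*2) = cce (tw i m).
Proof.
move=> m5 e; rewrite -(cce_double i m5).
have -> : m.*2 = 1 + m.*2.-1 by lia.
rewrite (tw_cat i.*2 1) -[in RHS](cce_rot 1) -[X in rot X _](size_tw i.*2 1).
rewrite rot_size_cat.
rewrite [1 + _]addnC tw_cat addn1; congr (cce (_ ++ _)).
apply/tw_eqP => -[|//] _.
rewrite !addn0 thue_morse_double (_ : _ + _ = (i + m).*2); last by lia.
by rewrite thue_morse_double e.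
Qed.

(** * The recursion for [ace] *)

Lemma aceE n r : ace n r <-> exists i, cce (tw i n) = r.
Proof.
split=> [[x [[i Ex] <- <-]]|[i <-]]; first by exists i; rewrite [x in RHS]Ex.
by exists (tw i n); split; [exists i; rewrite size_tw | rewrite size_tw |].
Qed.

(** These are the factors whose value is read at the seam: all of them for odd [n], and for even [n]
    those at odd positions with equal first and last letters. *)
Definition seam_ace n (r : rat) : Prop := exists i,
  [/\ 10 <= i, odd n \/ odd i /\ t i = t (i + n - 1)
    & r = ratio (seam_exponent (seam_pair i n))].

Lemma ace_odd n r : 20 <= n -> odd n -> ace n r <-> seam_ace n r.
Proof.
move=> n20 on; rewrite aceE; split=> [[i <-]|[i [_ _ ->]]]; last first.
  by exists i; rewrite cce_odd.
have [i' [i'10 _ <-]] := thue_morse_recurrent i n.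
by exists i'; split; [| left | rewrite cce_odd].
Qed.

Lemma ace_even m r : 10 <= m -> ace m.*2 r <-> ace m r \/ seam_ace m.*2 r.
Proof.
move=> m10; rewrite !aceE; split=> [[i <-]|[[i <-]|[i [i10 [om|[oi e]] ->]]]].
- have [ei|oi] := boolP (~~ odd i).
    by left; exists i./2; rewrite -{2}(even_halfK ei) cce_double //; lia.
  rewrite negbK in oi; have [e|ne] := eqVneq (t i./2) (t (i./2 + m)).
    left; exists i./2; rewrite -cce_double_odd //; last by lia.
    by congr (cce (tw _ _)); lia.
  have dd : t i = t (i + m.*2 - 1).
    rewrite (_ : i + m.*2 - 1 = (i./2 + m).*2); last by lia.
    rewrite thue_morse_double (_ : i = i./2.*2.+1); last by lia.
    rewrite thue_morse_doubleS (_ : i./2.*2.+1./2 = i./2); last by lia.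
    by case: (t i./2) ne; case: (t (i./2 + m)).
  have [i' [i'10 oi' E]] := thue_morse_recurrent i m.*2.
  have dd' : t i' = t (i' + m.*2 - 1).
    have /tw_eqP e := E.
    have := e 0 ltac:(lia); have := e (m.*2 - 1) ltac:(lia).
    by rewrite !addn0 !addnBA ?dd; [move=> -> -> | lia..].
  right; exists i'; split=> //; first by right; rewrite oi'.
  by rewrite -E cce_even_seam ?odd_double ?oi' //; lia.
- by exists i.*2; rewrite cce_double //; lia.
- by rewrite odd_double in om.
- by exists i; rewrite cce_even_seam ?odd_double //; lia.
Qed.

(** * Pairs of factors at a given distance *)

Definition pairs3 : seq (seq bool * seq bool) :=
  allpairs pair factors3 factors3.

Definition pair3 (k : nat) : seq bool * seq bool := nth ([::], [::]) pairs3 k.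

(** A pair at distance [q] yields pairs at distance [2 * q + b], one for each parity [a] of the
    first position. *)
Definition images (k : nat) (b : bool) : seq nat :=
  [seq index (sub a 3 (mu (pair3 k).1), sub (a + b) 3 (mu (pair3 k).2)) pairs3
  | a <- [:: 0; 1]].

(** Both inclusions matter: the first ensures that no exponent is missed, the second that every
    listed one occurs. *)
Definition pairs_spec (q : nat) (P : seq nat) : Prop :=
  (forall k, index (tw k 3, tw (k + q) 3) pairs3 \in P) /\
  (forall x, x \in P -> x < 36 /\ exists k, pair3 x = (tw k 3, tw (k + q) 3)).

Lemma pair3_index k l :
  pair3 (index (tw k 3, tw l 3) pairs3) = (tw k 3, tw l 3).
Proof.
rewrite /pair3 nth_index //; apply/allpairsP; exists (tw k 3, tw l 3).
by split; rewrite ?tw3_factors3.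
Qed.

Lemma index_pairs3_lt k l : index (tw k 3, tw l 3) pairs3 < 36.
Proof.
rewrite -[36]/(size pairs3) index_mem; apply/allpairsP; exists (tw k 3, tw l 3).
by split; rewrite ?tw3_factors3.
Qed.

Lemma images_tw x k q (b : bool) : pair3 x = (tw k 3, tw (k + q) 3) ->
  images x b = [seq index (tw (k.*2 + a) 3, tw (k.*2 + a + (q.*2 + b)) 3) pairs3
               | a <- [:: 0; 1]].
Proof.
move=> E; apply/eq_in_map => a a01; have a2 : a <= 1 by case: a a01 => [|[|]].
have b1 : b <= 1 by case: b.
rewrite E !mu_tw sub_tw ?sub_tw; [|lia..].
by have -> : (k + q).*2 + (a + b) = k.*2 + a + (q.*2 + b) by lia.
Qed.

Definition images_table : seq (seq nat * seq nat) :=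
  [seq (images k false, images k true) | k <- iota 0 36].

(** Filtering [iota 0 36] puts the set in a canonical order, so that equal sets give equal
    configurations. *)
Definition step (P : seq nat) (b : bool) : seq nat :=
  let Q := flatten [seq let I := nth ([::], [::]) images_table k in
                        if b then I.2 else I.1 | k <- P] in
  [seq k <- iota 0 36 | k \in Q].

Lemma nth_table (T : Type) (x0 : T) (f : nat -> T) n k : k < n ->
  nth x0 [seq f j | j <- iota 0 n] k = f k.
Proof. by move=> kn; rewrite (nth_map 0) ?size_iota // nth_iota. Qed.

Lemma mem_step (P : seq nat) b x : (forall y, y \in P -> y < 36) ->
  x \in step P b <-> x < 36 /\ exists2 y, y \in P & x \in images y b.
Proof.
move=> P36; rewrite mem_filter mem_iota leq0n add0n andTb.
have row y : y \in P ->
    (if b then (nth ([::], [::]) images_table y).2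
     else (nth ([::], [::]) images_table y).1) = images y b.
  by move=> /P36 y36; rewrite nth_table //; case: b.
split=> [/andP[/flatten_mapP/=[y yP xy] x36]|[x36 [y yP xy]]].
  by split=> //; exists y; rewrite // -row.
by rewrite x36 andbT; apply/flatten_mapP; exists y; rewrite //= row.
Qed.

Lemma step_spec q P (b : bool) :
  pairs_spec q P -> pairs_spec (q.*2 + b) (step P b).
Proof.
case=> H1 H2; have P36 y : y \in P -> y < 36 by move/H2 => [].
split=> [k|x /(mem_step _ _ P36)[x36 [y yP]]].
  apply/(mem_step _ _ P36); split; first exact: index_pairs3_lt.
  exists (index (tw k./2 3, tw (k./2 + q) 3) pairs3) => //.
  rewrite (images_tw _ (pair3_index _ _)); apply/mapP; exists (odd k : nat).
    by case: odd.
  by have -> : k./2.*2 + odd k = k by lia.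
have [y36 [k Ey]] := H2 y yP; rewrite (images_tw _ Ey) => /mapP[a _ ->].
by split; [exact: index_pairs3_lt | exists (k.*2 + a); apply: pair3_index].
Qed.

(** * Finite sets of exponents and the seam table *)

Definition realizes (A : seq (nat * nat)) (r : rat) : Prop :=
  exists2 c, c \in A & r = ratio c.

Lemma realizes_cat A B r : realizes (A ++ B) r <-> realizes A r \/ realizes B r.
Proof.
split=> [[c]|[] [c cA ->]]; try by exists c; rewrite // mem_cat cA ?orbT.
by rewrite mem_cat => /orP[] cA ->; [left | right]; exists c.
Qed.

(** The fractions returned by [best] need not be reduced, so they are compared as ratios. *)
Definition eqr (c d : nat * nat) : bool :=
  [&& 0 < c.2, 0 < d.2 & c.1 * d.2 == d.1 * c.2].

Lemma eqr_ratio c d : eqr c d -> ratio c = ratio d.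
Proof.
case/and3P=> c0 d0 /eqP e; apply/eqP; rewrite eq_le !ratio_le // /fac_le.
by rewrite e leqnn.
Qed.

Definition seteq (A B : seq (nat * nat)) : bool :=
  all (fun c => has (eqr c) B) A && all (fun d => has (eqr d) A) B.

Lemma realizes_seteq A B r : seteq A B -> realizes A r <-> realizes B r.
Proof.
case/andP=> /allP AB /allP BA; split=> [] [c cA ->].
  by have /hasP[d dB /eqr_ratio ->] := AB c cA; exists d.
by have /hasP[d dB /eqr_ratio ->] := BA c cA; exists d.
Qed.

(** For [n = 16 * q + r] and [i = 16 * k + a + 10], the last ten letters of the factor lie in the
    image of the block at [k + q] and the first ten in that of the block at [k]; hence the order of
    the components. *)
Definition window (k r a : nat) : seq bool * seq bool :=
  (sub (a + r) 10 (iter 4 mu (pair3 k).2),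
   sub (a + 10) 10 (iter 4 mu (pair3 k).1)).

Definition eligible (r a : nat) (w : seq bool * seq bool) : bool :=
  odd r || odd a && (last false w.1 == head false w.2).

Definition seam_exponents (k r : nat) : seq (nat * nat) :=
  undup [seq seam_exponent (window k r a)
        | a <- iota 0 16 & eligible r a (window k r a)].

Definition seam_table : seq (seq (seq (nat * nat))) :=
  [seq [seq seam_exponents k r | r <- iota 0 16] | k <- iota 0 36].

Definition seam_lookup (P : seq nat) (r : nat) : seq (nat * nat) :=
  undup (flatten [seq nth [::] (nth [::] seam_table k) r | k <- P]).

Lemma mem_seam_lookup (P : seq nat) r c :
  (forall y, y \in P -> y < 36) -> r < 16 ->
  c \in seam_lookup P r <-> exists2 x, x \in P & c \in seam_exponents x r.
Proof.
move=> P36 r16; rewrite mem_undup.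
have row y : y \in P ->
    nth [::] (nth [::] seam_table y) r = seam_exponents y r.
  by move=> /P36 y36; rewrite nth_table // nth_table.
by split=> [/flatten_mapP[y yP]|[y yP cy]]; rewrite ?row //;
  [exists y | apply/flatten_mapP; exists y; rewrite ?row].
Qed.

Lemma seam_lookup_spec q r P x : pairs_spec q P -> r < 16 -> 20 <= 16 * q + r ->
  realizes (seam_lookup P r) x <-> seam_ace (16 * q + r) x.
Proof.
move=> [H1 H2] r16 n20.
have P36 y : y \in P -> y < 36 by move/H2 => [].
have window_tw y k a : pair3 y = (tw k 3, tw (k + q) 3) -> a < 16 ->
    window y r a = seam_pair (16 * k + a + 10) (16 * q + r).
  move=> E a16; rewrite /window E !tw_block; [|lia..].
  by congr (tw _ _, tw _ _); lia.
have eligibleE i a : odd i = odd a ->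
    eligible r a (seam_pair i (16 * q + r)) <->
    odd (16 * q + r) \/ odd i /\ t i = t (i + (16 * q + r) - 1).
  move=> ia; rewrite /eligible ia (_ : odd (_ + r) = odd r); last by lia.
  have -> : last false (seam_pair i (16 * q + r)).1 = t (i + (16 * q + r) - 1).
    rewrite (last_nth false) size_tw.
    rewrite -[LHS]/(nth false (tw (i + (16 * q + r) - 10) 10) 9) nth_tw //.
    by congr t; lia.
  have -> : head false (seam_pair i (16 * q + r)).2 = t i.
    by rewrite -nth0 nth_tw // addn0.
  split=> [/orP[o|/andP[o /eqP e]]|[o|[o e]]].
  - by left.
  - by right.
  - by rewrite o.
  - by rewrite o e eqxx orbT.
split=> [[c /(mem_seam_lookup _ P36 r16)[y yP]]|[i [i10 el ->]]].
  rewrite mem_undup => /mapP[a].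
  rewrite mem_filter mem_iota => /andP[el a16] -> ->.
  have [_ [k Ey]] := H2 y yP; rewrite (window_tw _ _ _ Ey) // in el *.
  exists (16 * k + a + 10); split=> //; first by lia.
  by apply/(eligibleE _ a) => //; lia.
exists (seam_exponent (seam_pair i (16 * q + r))) => //.
apply/(mem_seam_lookup _ P36 r16).
pose k := (i - 10) %/ 16; pose a := (i - 10) %% 16.
have Ei : i = 16 * k + a + 10 by rewrite /k /a; lia.
have a16 : a < 16 by rewrite /a ltn_mod.
exists (index (tw k 3, tw (k + q) 3) pairs3) => //.
rewrite mem_undup; apply/mapP; exists a; last first.
  by rewrite (window_tw _ k) ?pair3_index // -Ei.
rewrite mem_filter mem_iota a16 andbT (window_tw _ k) ?pair3_index // -Ei.
by rewrite andbT; apply/(eligibleE i a); [lia | exact: el].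
Qed.

(** * The automaton *)

Definition diagonal : seq nat := [seq index (u, u) pairs3 | u <- factors3].

Lemma diagonal_spec : pairs_spec 0 diagonal.
Proof.
split=> [k|x /mapP[u /factors3_tw[k ->] ->]].
  by rewrite addn0; apply/mapP; exists (tw k 3); first exact: tw3_factors3.
by split; [exact: index_pairs3_lt | exists k; rewrite pair3_index addn0].
Qed.

(* States 1 to 48 come from minimizing the graph of the configurations below;
   state 0 is the initial state, left by the leading digit 1. *)
Definition delta_table : seq (nat * nat) := [::
  (0, 1); (2, 3); (4, 5); (6, 7); (8, 9); (10, 11); (12, 13); (14, 15);
  (16, 17); (18, 19); (20, 21); (22, 23); (12, 24); (25, 26); (14, 24);
  (27, 28); (29, 30); (31, 32); (27, 33); (34, 28); (35, 36); (37, 26);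
  (22, 24); (38, 28); (39, 26); (25, 24); (40, 28); (27, 24); (41, 28);
  (16, 42); (43, 19); (44, 24); (40, 23); (45, 26); (34, 24); (35, 24);
  (46, 26); (37, 24); (38, 24); (39, 24); (40, 24); (41, 24); (47, 32);
  (39, 33); (46, 36); (45, 24); (46, 24); (48, 24); (39, 36)].

Definition out_table : seq (seq (nat * nat)) := [::
  [::]; [:: (1, 1)]; [:: (1, 1); (2, 1)]; [:: (2, 1)]; [:: (2, 1); (3, 1)];
  [:: (5, 2); (3, 1)]; [:: (2, 1); (4, 1)]; [:: (7, 3); (3, 1); (7, 2)];
  [:: (2, 1); (3, 1); (4, 1)]; [:: (5, 2); (8, 3); (3, 1)];
  [:: (5, 2); (3, 1); (10, 3); (4, 1)]; [:: (5, 2); (3, 1); (7, 2)];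
  [:: (2, 1); (3, 1); (4, 1)]; [:: (7, 3); (13, 5); (8, 3); (3, 1)];
  [:: (7, 3); (3, 1); (7, 2); (4, 1)]; [:: (5, 2); (8, 3); (3, 1)];
  [:: (2, 1); (3, 1); (4, 1)]; [:: (5, 2); (13, 5); (8, 3); (3, 1)];
  [:: (5, 2); (8, 3); (3, 1); (11, 3); (4, 1)];
  [:: (7, 3); (8, 3); (3, 1); (7, 2)]; [:: (5, 2); (3, 1); (10, 3); (4, 1)];
  [:: (7, 3); (5, 2); (8, 3); (3, 1)];
  [:: (5, 2); (3, 1); (7, 2); (11, 3); (4, 1)];
  [:: (17, 7); (5, 2); (3, 1); (7, 2)];
  [:: (7, 3); (5, 2); (13, 5); (8, 3); (3, 1)];
  [:: (7, 3); (13, 5); (8, 3); (3, 1); (10, 3); (4, 1)];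
  [:: (7, 3); (5, 2); (8, 3); (3, 1); (7, 2)];
  [:: (5, 2); (8, 3); (3, 1); (11, 3); (4, 1)];
  [:: (17, 7); (5, 2); (8, 3); (3, 1); (7, 2)]; [:: (2, 1); (3, 1); (4, 1)];
  [:: (7, 3); (5, 2); (13, 5); (8, 3); (3, 1)];
  [:: (5, 2); (13, 5); (8, 3); (3, 1); (10, 3); (11, 3); (4, 1)];
  [:: (7, 3); (5, 2); (8, 3); (3, 1); (7, 2)];
  [:: (7, 3); (5, 2); (13, 5); (8, 3); (3, 1)];
  [:: (7, 3); (8, 3); (3, 1); (7, 2); (4, 1)];
  [:: (5, 2); (3, 1); (10, 3); (4, 1)]; [:: (5, 2); (13, 5); (8, 3); (3, 1)];
  [:: (7, 3); (5, 2); (8, 3); (3, 1); (10, 3); (11, 3); (4, 1)];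
  [:: (17, 7); (5, 2); (3, 1); (7, 2); (11, 3); (4, 1)];
  [:: (7, 3); (5, 2); (13, 5); (8, 3); (3, 1); (10, 3); (11, 3); (4, 1)];
  [:: (7, 3); (5, 2); (8, 3); (3, 1); (7, 2); (11, 3); (4, 1)];
  [:: (17, 7); (5, 2); (8, 3); (3, 1); (7, 2); (11, 3); (4, 1)];
  [:: (7, 3); (5, 2); (13, 5); (8, 3); (3, 1)];
  [:: (7, 3); (5, 2); (13, 5); (8, 3); (3, 1); (10, 3); (11, 3); (4, 1)];
  [:: (5, 2); (13, 5); (8, 3); (3, 1); (10, 3); (11, 3); (4, 1)];
  [:: (7, 3); (5, 2); (13, 5); (8, 3); (3, 1); (10, 3); (4, 1)];
  [:: (5, 2); (13, 5); (8, 3); (3, 1); (10, 3); (11, 3); (4, 1)];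
  [:: (7, 3); (5, 2); (13, 5); (8, 3); (3, 1); (10, 3); (11, 3); (4, 1)];
  [:: (7, 3); (5, 2); (13, 5); (8, 3); (3, 1); (10, 3); (11, 3); (4, 1)]].

Definition delta (s : nat) (b : bool) : nat :=
  let row := nth (0, 0) delta_table s in if b then row.2 else row.1.

Definition out (s : nat) : seq (nat * nat) := nth [::] out_table s.

Definition run (n : nat) : nat :=
  foldl (fun s (d : 'I_2) => delta s (d == 1 :> nat)) 0 (base2 n).

Lemma base2_rec_fuel f g n : n <= f -> n <= g -> base2_rec f n = base2_rec g n.
Proof.
elim: f g n => [|f IH] [|g] [|n] //= nf ng; congr rcons.
by apply: IH; lia.
Qed.

Lemma base2_bit n (b : bool) : 0 < n ->
  base2 (n.*2 + b) = rcons (base2 n) (inZp (n.*2 + b)).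
Proof.
move=> n0; have recS f m : 0 < m ->
    base2_rec f.+1 m = rcons (base2_rec f m./2) (inZp m) by case: m.
rewrite /base2 -{1}[n.*2 + b]prednK ?recS; [|lia..].
rewrite (_ : (n.*2 + b)./2 = n); last by case: b; lia.
by congr rcons; apply: base2_rec_fuel; lia.
Qed.

Lemma run_bit n (b : bool) : 0 < n -> run (n.*2 + b) = delta (run n) b.
Proof.
move=> n0; rewrite /run base2_bit // -cats1 foldl_cat /=; congr delta.
by rewrite addnC modn2 oddD odd_double addbF; case: b.
Qed.

Lemma run_half n : 1 < n -> run n = delta (run n./2) (odd n).
Proof.
move=> n1; have {1}-> : n = n./2.*2 + odd n by lia.
by apply: run_bit; lia.
Qed.

(* The state of the automaton on n, n modulo 16, and the pairs of factors of
   length 3 occurring at distance n %/ 16. *)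
Definition config : Type := nat * nat * seq nat.

(** Writing [n = 16 * q + r], the quotient of [2 * n + b] by 16 is [2 * q + 1] if [8 <= r] and
    [2 * q] otherwise. *)
Definition next (c : config) (b : bool) : config :=
  (delta c.1.1 b, (c.1.2.*2 + b) %% 16, step c.2 (8 <= c.1.2)).

(** Breadth-first exploration; that its result is closed under [next] is checked afterwards in
    [reach_closed]. *)
Fixpoint search (fuel : nat) (todo seen : seq config) : seq config :=
  if fuel is fuel'.+1 then
    if todo is c :: todo' then
      let new := [seq d <- [:: next c false; next c true] | d \notin seen] in
      search fuel' (todo' ++ new) (new ++ seen)
    else seen
  else seen.

(** Repeated halving of any [n >= 20] lands in 10 to 19, where the quotient by 16 is 0 or 1. *)
Definition start : seq config :=
  [seq (run n, n %% 16, if n < 16 then diagonal else step diagonal true)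
  | n <- iota 10 10].

Definition reach : seq config := search 2000 start start.

(** The second condition is the recursion of [ace_odd] and [ace_even] on outputs: a digit 0 inherits
    the previous set, a digit 1 does not. *)
Definition closed_config (c : config) (b : bool) : bool :=
  let d := next c b in
  (d \in reach) &&
  seteq (out d.1.1)
        (seam_lookup d.2 d.1.2 ++ (if b then [::] else out c.1.1)).

Definition ace_small (n : nat) : seq (nat * nat) :=
  undup [seq best (x ++ x) n n
        | x <- undup [seq sub a n (iter 4 mu u)
                     | u <- factors3, a <- iota 0 16]].

Lemma reach_closed :
  all (fun c => all (closed_config c) [:: false; true]) reach.
Proof. by vm_cast_no_check (erefl true). Qed.

Lemma start_reach : all (fun c => c \in reach) start.
Proof. by vm_cast_no_check (erefl true). Qed.

Lemma small_check :
  all (fun n => seteq (out (run n)) (ace_small n)) (iota 1 19).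
Proof. by vm_cast_no_check (erefl true). Qed.

Lemma ace_small_spec n x : 0 < n < 33 -> realizes (ace_small n) x <-> ace n x.
Proof.
move=> n33; rewrite aceE; have nonnil i : tw i n != [::].
  by apply: size_gt0_neq_nil; rewrite size_tw; lia.
split=> [[c]|[i <-]].
  rewrite mem_undup => /mapP[w].
  rewrite mem_undup => /allpairsP[ua [uf ai ->]] -> ->.
  have [k ->] := factors3_tw uf; move: ai; rewrite mem_iota => a16.
  rewrite tw_block; last by lia.
  by exists (16 * k + ua.2); rewrite cce_best // !size_tw.
rewrite cce_best // !size_tw; eexists; last by [].
rewrite mem_undup; apply/mapP; exists (tw i n) => //; rewrite mem_undup.
apply/allpairsP; exists (tw (i %/ 16) 3, i %% 16); split.
- exact: tw3_factors3.
- by rewrite mem_iota /= ltn_mod.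
- by rewrite /= tw_block; [congr (tw _ _); lia | lia].
Qed.

Lemma all_bool (P : pred bool) : all P [:: false; true] -> forall b, P b.
Proof. by rewrite /= andbT => /andP[? ?] []. Qed.

Opaque reach seam_lookup.

Lemma reach_next c (b : bool) : c \in reach ->
  next c b \in reach /\
  seteq (out (next c b).1.1)
        (seam_lookup (next c b).2 (next c b).1.2 ++
         (if b then [::] else out c.1.1)).
Proof.
have /allP closed := reach_closed.
by move=> /closed/all_bool/(_ b); rewrite /closed_config => /andP.
Qed.

Lemma run_reach n : 10 <= n ->
  exists2 P, (run n, n %% 16, P) \in reach & pairs_spec (n %/ 16) P.
Proof.
elim/ltn_ind: n => n IH n10; have [n20|n20] := ltnP n 20.
  exists (if n < 16 then diagonal else step diagonal true).
    have /allP := start_reach; apply; apply/mapP; exists n => //.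
    by rewrite mem_iota; lia.
  case: ltnP => n16; first by rewrite divn_small //; exact: diagonal_spec.
  rewrite (_ : n %/ 16 = 0.*2 + true); last by lia.
  exact: step_spec diagonal_spec.
have [P Pr Pq] := IH n./2 ltac:(lia) ltac:(lia).
have [dr _] := reach_next (odd n) Pr.
have En : n = n./2.*2 + odd n by lia.
exists (step P (8 <= n./2 %% 16)).
  have E1 := @run_half n ltac:(lia).
  have E2 : ((n./2 %% 16).*2 + odd n) %% 16 = n %% 16 by lia.
  by rewrite E1 -E2.
have -> : n %/ 16 = (n./2 %/ 16).*2 + (8 <= n./2 %% 16) by lia.
exact: step_spec.
Qed.

(** Strong induction: lengths below 20 are compared with an enumeration of all factors, and longer
    ones follow from [n / 2] by the recursion checked on [reach]. *)
Lemma out_spec n x : 0 < n -> realizes (out (run n)) x <-> ace n x.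
Proof.
elim/ltn_ind: n x => n IH x n0; have [n20|n20] := ltnP n 20.
  have /allP/(_ n) := small_check; rewrite mem_iota => /(_ ltac:(lia)) h.
  by rewrite (realizes_seteq _ h); apply: ace_small_spec; lia.
have [P Pr Pq] := @run_reach n./2 ltac:(lia).
have [_] := reach_next (odd n) Pr.
rewrite [(next _ _).1.1]/= -run_half; last by lia.
move=> h; rewrite (realizes_seteq _ h) realizes_cat {h}.
have spec := @step_spec _ _ (8 <= n./2 %% 16) Pq.
rewrite [(next _ _).2]/= [(next _ _).1.2]/=.
have -> : ((n./2 %% 16).*2 + odd n) %% 16 = n %% 16 by lia.
rewrite (seam_lookup_spec _ spec); [|lia..].
have -> : 16 * ((n./2 %/ 16).*2 + (8 <= n./2 %% 16)) + n %% 16 = n by lia.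
have [on|en] := boolP (odd n).
  rewrite (ace_odd _ n20 on); split=> [[h|[c]]|h]; [exact: h | | by left].
  by rewrite in_nil.
have := @ace_even n./2 x ltac:(lia); rewrite (even_halfK en) => ->.
have [out_ace ace_out] := IH n./2 ltac:(lia) x ltac:(lia).
split=> [[h|/out_ace h]|[/ace_out h|h]].
- by right; exact: h.
- by left; exact: h.
- by right; exact: h.
- by left; exact: h.
Qed.

(** * The tables as a [dfao] with 49 states *)

Lemma delta_lt s b : delta s b < 49.
Proof.
have [ltn|s49] := ltnP s 49; last by rewrite /delta nth_default //; case: b.
have /allP : all (fun s => (delta s true < 49) && (delta s false < 49))
               (iota 0 49) by [].
by move=> /(_ s); rewrite mem_iota => /(_ ltn) /andP[]; case: b.
Qed.

Definition output_set (s : 'I_49) : {fset rat} :=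
  [fset x in [seq ratio c | c <- out s]]%fset.

Definition ace_alphabet : {fset {fset rat}} :=
  [fset output_set s | s in 'I_49]%fset.

Lemma output_set_alphabet s : output_set s \in ace_alphabet.
Proof. by apply/imfsetP; exists s. Qed.

Definition ace_dfao : dfao 2 {fset rat} :=
  @Dfao 2 {fset rat} 'I_49 ord0 (fun s d => inord (delta s (d == 1 :> nat)))
    ace_alphabet (fun s => [` output_set_alphabet s]%fset).

Lemma ace_dfao_run n :
  foldl (@dfao_trans _ _ ace_dfao) ord0 (base2 n) = run n :> nat.
Proof.
rewrite /run; elim/last_ind: (base2 n) => //= w d IH.
by rewrite -cats1 !foldl_cat /= inordK ?delta_lt // IH.
Qed.

Theorem theorem17 :
  exists M : dfao 2 {fset rat},
    #|dfao_state M| = 49 /\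
    forall n : nat, 1 <= n ->
      [set` dfao_output M (base2 n)]%classic = ace n.
Proof.
exists ace_dfao; split=> [|n n1]; first by rewrite card_ord.
apply/seteqP; split=> x /=.
  rewrite !inE /= ace_dfao_run => /mapP[c cA ->].
  by apply/out_spec => //; exists c.
move/out_spec => /(_ n1)[c cA ->].
by rewrite !inE /= ace_dfao_run; apply: map_f.
Qed.
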